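(* Let $A\in\mathcal{S}_{N,p}$ be a symmetric $p$-semiseparable matrix with Givens-vector representation $\boldsymbol c_i,\boldsymbol s_i,\hat{\boldsymbol\nu}_i\in\mathbb{R}^p$ ($i=1,\dots,N$), let $S_i=\operatorname{diag}(\boldsymbol s_i)$, and let $D=\operatorname{diag}(d_1,\dots,d_N)$ with $d_i>0$ for all $i$. Suppose $A+D$ is positive definite, with Cholesky factor $L$ represented by $\boldsymbol c_i$, $\boldsymbol s_i$, $\boldsymbol w_i\in\mathbb{R}^p$ and $f_i>0$ as in the context. Define recursively $R_N=\boldsymbol 0_{p\times p}$, $\boldsymbol p_N=\boldsymbol 0_p$, $b_N=f_N^{-2}$ and, for $i=N-1,N-2,\dots,1$, $$P_i=b_{i+1}\boldsymbol c_{i+1}\boldsymbol c_{i+1}^T-f_{i+1}^{-1}\big(\boldsymbol c_{i+1}\boldsymbol p_{i+1}^T+\boldsymbol p_{i+1}\boldsymbol c_{i+1}^T\big)+R_{i+1},$$ $$R_i=S_i^TP_iS_i,\qquad \boldsymbol p_i=R_i\boldsymbol w_i,\qquad b_i=f_i^{-2}(1+\boldsymbol w_i^T\boldsymbol p_i).$$ Then, for every $i=1,\dots,N$, $b_i$ is the $i$-th diagonal element of $(A+D)^{-1}$, i.e. $b_i=\boldsymbol e_i^T(A+D)^{-1}\boldsymbol e_i=\|L^{-1}\boldsymbol e_i\|_2^2$, where $\boldsymbol e_i$ is the $i$-th standard basis vector of $\mathbb{R}^N$. The recursion computes all the $b_i$ from $\boldsymbol c_i,\boldsymbol s_i,\boldsymbol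 w_i,f_i$ in $\mathcal{O}(Np^2)$ arithmetic operations.
   Context: For a sequence of $p\times p$ matrices, $S^{>}_{i:j}=S_iS_{i-1}\cdots S_j$ for $i\ge j$ and $S^{>}_{i:j}=I_p$ for $i<j$. Definition of $\mathcal{S}_{N,p}$: a symmetric matrix $A\in\mathbb{R}^{N\times N}$ is $p$-semiseparable ($A\in\mathcal{S}_{N,p}$) if $\operatorname{rank}(A(i:N,1:i))\le p$ for all $i=1,\dots,N$, with equality for at least one $i$. Here $A(i:N,1:i)$ is the submatrix of rows $i,\dots,N$ and columns $1,\dots,i$. Givens-vector representation (GvR): vectors $\boldsymbol c_i,\boldsymbol s_i,\hat{\boldsymbol\nu}_i\in\mathbb{R}^p$ ($i=1,\dots,N$), with components $c_{i,k},s_{i,k},\hat\nu_{i,k}$, form a GvR of a symmetric $A$ if $c_{i,k}^2+s_{i,k}^2=1$ for all $i\le N-1$, $k\le p$, with the convention $c_{N,k}=1$, $s_{N,k}=0$, and, with $S_i=\operatorname{diag}(\boldsymbol s_i)$, $A(i,j)=\boldsymbol c_i^TS^{>}_{i-1:j}\hat{\boldsymbol\nu}_j$ for $1\le j\le i\le N$ (entries above the diagonal by symmetry). Representation of the Cholesky factor of $A+D=LL^T$: $L(i,j)=\boldsymbol c_i^TS^{>}_{i-1:j}\boldsymbol w_j$ for $1\le j<i\le N$ and $L(i,i)=f_i$, where $f_i=\sqrt{\boldsymbol c_i^T(\hat{\boldsymbol\nu}_i-Q_i\boldsymbol c_i)+d_i}$ for $i=1,\dots,N$ and $\boldsymbol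 w_i=(\hat{\boldsymbol\nu}_i-Q_i\boldsymbol c_i)/f_i$ for $i=1,\dots,N-1$, with $Q_1=\boldsymbol 0_{p\times p}$ and $Q_i=S_{i-1}(\boldsymbol w_{i-1}\boldsymbol w_{i-1}^T+Q_{i-1})S_{i-1}$ for $i=2,\dots,N$. *)

(* Defs.v *)
From HB Require Import structures.
From mathcomp Require Import all_boot all_order all_algebra.

Set Implicit Arguments.
Unset Strict Implicit.
Unset Printing Implicit Defensive.

Import Order.TTheory GRing.Theory Num.Theory.
Local Open Scope ring_scope.

(* Indexing.  Sequences of vectors, matrices or scalars are functions on nat
   whose meaningful indices are 1, ..., N; the other values are junk.  Matrix
   rows and columns are ordinals, so the ordinal i : 'I_N is the 1-based index
   i.+1. *)

(* S^>_{i:j} = S_i S_{i-1} ... S_j, and the identity when i < j. *)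
Definition prodgt (R : pzRingType) (p : nat) (S : nat -> 'M[R]_p)
    (i j : nat) : 'M[R]_p :=
  \big[mulmx/1%:M]_(k <- rev (index_iota j i.+1)) S k.

Definition diagv (R : pzRingType) (p : nat) (v : nat -> 'cV[R]_p)
    (i : nat) : 'M[R]_p := diag_mx (v i)^T.

(* The scalar u^T v. *)
Definition dotv (R : pzRingType) (p : nat) (u v : 'cV[R]_p) : R :=
  (u^T *m v) 0 0.

Definition norm2 (R : rcfType) (n : nat) (v : 'cV[R]_n) : R :=
  Num.sqrt (\sum_k v k 0 ^+ 2).

Definition stdvec (R : pzRingType) (n : nat) (i : 'I_n) : 'cV[R]_n :=
  delta_mx i 0.

Definition posdef (R : numDomainType) (n : nat) (M : 'M[R]_n) : Prop :=
  M^T = M /\ forall x : 'cV[R]_n, x != 0 -> 0 < dotv x (M *m x).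

(* A(i:N, 1:i): enum_val lists the selected ordinals in increasing order. *)
Definition lowerleft (R : Type) (N : nat) (A : 'M[R]_N) (i : 'I_N) :=
  mxsub (@enum_val _ [pred k : 'I_N | (i <= k)%N])
        (@enum_val _ [pred l : 'I_N | (l <= i)%N]) A.

Definition semiseparable (R : fieldType) (N p : nat) (A : 'M[R]_N) : Prop :=
  [/\ A^T = A,
      forall i : 'I_N, (\rank (lowerleft A i) <= p)%N &
      exists i : 'I_N, \rank (lowerleft A i) = p].

Definition givens_vector_rep (R : pzRingType) (N p : nat) (A : 'M[R]_N)
    (c s nu : nat -> 'cV[R]_p) : Prop :=
  [/\ forall (i : nat) (k : 'I_p), (1 <= i)%N -> (i < N)%N ->
        c i k 0 ^+ 2 + s i k 0 ^+ 2 = 1,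
      forall k : 'I_p, c N k 0 = 1 /\ s N k 0 = 0,
      forall i j : 'I_N, (j <= i)%N ->
        A i j = dotv (c i.+1) (prodgt (diagv s) i j.+1 *m nu j.+1) &
      A^T = A].

Definition is_cholesky (R : numDomainType) (N : nat) (M L : 'M[R]_N) : Prop :=
  [/\ forall i j : 'I_N, (i < j)%N -> L i j = 0,
      forall i : 'I_N, 0 < L i i &
      M = L *m L^T].

(* Q_1 = 0 and Q_{i+1} = S_i (w_i w_i^T + Q_i) S_i; index 0 is junk. *)
Fixpoint cholQ (R : pzRingType) (p : nat) (s w : nat -> 'cV[R]_p)
    (i : nat) : 'M[R]_p :=
  if i is (i'.+1 as i1).+1 then
    diagv s i1 *m (w i1 *m (w i1)^T + cholQ s w i1) *m diagv s i1
  else 0.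

Definition cholesky_rep (R : rcfType) (N p : nat) (L : 'M[R]_N)
    (c s nu : nat -> 'cV[R]_p) (d : nat -> R)
    (w : nat -> 'cV[R]_p) (f : nat -> R) : Prop :=
  [/\ forall i j : 'I_N, (j < i)%N ->
        L i j = dotv (c i.+1) (prodgt (diagv s) i j.+1 *m w j.+1),
      forall i : 'I_N, L i i = f i.+1,
      forall i : nat, (1 <= i)%N -> (i <= N)%N ->
        f i = Num.sqrt (dotv (c i) (nu i - cholQ s w i *m c i) + d i) &
      forall i : nat, (1 <= i)%N -> (i < N)%N ->
        w i = (f i)^-1 *: (nu i - cholQ s w i *m c i)].

Section BackwardRecursion.

Variables (R : fieldType) (p : nat).
Variables (c s w : nat -> 'cV[R]_p) (f : nat -> R).

Record rec_state := RecState {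
  st_R : 'M[R]_p;
  st_p : 'cV[R]_p;
  st_b : R
}.

(* P_i, from the state at index i+1. *)
Definition rec_P (i : nat) (st : rec_state) : 'M[R]_p :=
  st_b st *: (c i.+1 *m (c i.+1)^T)
  - (f i.+1)^-1 *: (c i.+1 *m (st_p st)^T + st_p st *m (c i.+1)^T)
  + st_R st.

Definition rec_step (i : nat) (st : rec_state) : rec_state :=
  let Ri := (diagv s i)^T *m rec_P i st *m diagv s i in
  let pi := Ri *m w i in
  RecState Ri pi (f i ^- 2 * (1 + dotv (w i) pi)).

(* The state at index i when N = i + k. *)
Fixpoint rec_from (k i : nat) : rec_state :=
  if k is k'.+1 then rec_step i (rec_from k' i.+1)
  else RecState 0 0 (f i ^- 2).

Definition seqR (N i : nat) : 'M[R]_p := st_R (rec_from (N - i) i).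
Definition seqp (N i : nat) : 'cV[R]_p := st_p (rec_from (N - i) i).
Definition seqb (N i : nat) : R := st_b (rec_from (N - i) i).
Definition seqP (N i : nat) : 'M[R]_p := rec_P i (rec_from (N - i.+1) i.+1).

Lemma seq_last (N : nat) :
  [/\ seqR N N = 0, seqp N N = 0 & seqb N N = f N ^- 2].
Proof. by rewrite /seqR /seqp /seqb subnn. Qed.

Lemma seq_step (N i : nat) : (i < N)%N ->
  [/\ seqP N i = seqb N i.+1 *: (c i.+1 *m (c i.+1)^T)
        - (f i.+1)^-1 *: (c i.+1 *m (seqp N i.+1)^T
                          + seqp N i.+1 *m (c i.+1)^T)
        + seqR N i.+1,
      seqR N i = (diagv s i)^T *m seqP N i *m diagv s i,
      seqp N i = seqR N i *m w i &
      seqb N i = f i ^- 2 * (1 + dotv (w i) (seqp N i))].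
Proof. by move=> ltiN; rewrite /seqP /seqR /seqp /seqb -(subnSK ltiN). Qed.

End BackwardRecursion.

(* Operation counts are in the algebraic model: a straight-line program over
   the inputs and integer constants, each instruction performing one field
   operation on operands already available.  Its cost is its length. *)
Variant arith_op := OpAdd | OpSub | OpMul | OpDiv.

Variant operand (X : Type) :=
  | Input of X
  | Const of int
  | Result of nat. (* value of the k-th instruction, counted from 0 *)
Arguments Const {X} z.
Arguments Result {X} k.

Record instr (X : Type) := Instr {
  ins_op : arith_op;
  ins_lhs : operand X;
  ins_rhs : operand X
}.

Definition slp (X : Type) := seq (instr X).

(* A Result that has not been computed yet reads as 0, which is also available
   as a constant. *)
Definition operand_val (R : fieldType) (X : Type) (x : X -> R) (vals : seq R)
    (o : operand X) : R :=
  match o with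
  | Input v => x v
  | Const z => z%:~R
  | Result k => vals`_k
  end.

(* Division by zero aborts. *)
Definition arith_val (R : fieldType) (op : arith_op) (a b : R) : option R :=
  match op with
  | OpAdd => Some (a + b)
  | OpSub => Some (a - b)
  | OpMul => Some (a * b)
  | OpDiv => if b == 0 then None else Some (a / b)
  end.

Fixpoint slp_run (R : fieldType) (X : Type) (x : X -> R) (vals : seq R)
    (prog : slp X) : option (seq R) :=
  if prog is ins :: prog' then
    obind (fun v => slp_run x (rcons vals v) prog')
      (arith_val (ins_op ins) (operand_val x vals (ins_lhs ins))
                              (operand_val x vals (ins_rhs ins)))
  else Some vals.

(* The components of c_i, s_i and the f_i for i <= N, and those of w_i for
   i <= N - 1, the range on which the w_i are defined. *)
Variant rec_input (N p : nat) :=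
  | InC of 'I_N & 'I_p
  | InS of 'I_N & 'I_p
  | InW of 'I_N.-1 & 'I_p
  | InF of 'I_N.

Definition rec_input_val (R : fieldType) (N p : nat)
    (c s w : nat -> 'cV[R]_p) (f : nat -> R) (v : rec_input N p) : R :=
  match v with
  | InC i k => c i.+1 k 0
  | InS i k => s i.+1 k 0
  | InW i k => w i.+1 k 0
  | InF i => f i.+1
  end.

(* prog evaluates the recursion: there are fixed places, independent of the
   input data, where every entry of every P_i, R_i, p_i and every b_i is found
   after running prog on any data for which the recursion makes sense. *)
Definition evaluates_recursion (R : fieldType) (N p : nat)
    (prog : slp (rec_input N p)) : Prop :=
  exists (oP oR : nat -> 'I_p -> 'I_p -> operand (rec_input N p))
         (op : nat -> 'I_p -> operand (rec_input N p))
         (ob : nat -> operand (rec_input N p)),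
  forall (c s w : nat -> 'cV[R]_p) (f : nat -> R),
    (forall i : nat, (1 <= i)%N -> (i <= N)%N -> f i != 0) ->
  exists2 vals : seq R,
    slp_run (rec_input_val c s w f) [::] prog = Some vals &
    let val := operand_val (rec_input_val c s w f) vals in
    [/\ forall (i : nat) (k l : 'I_p), (1 <= i)%N -> (i < N)%N ->
          val (oP i k l) = seqP c s w f N i k l,
        forall (i : nat) (k l : 'I_p), (1 <= i)%N -> (i <= N)%N ->
          val (oR i k l) = seqR c s w f N i k l,
        forall (i : nat) (k : 'I_p), (1 <= i)%N -> (i <= N)%N ->
          val (op i k) = seqp c s w f N i k 0 &
        forall i : nat, (1 <= i)%N -> (i <= N)%N ->
          val (ob i) = seqb c s w f N i].

(* Main.v *)
Require Import Defs.
From HB Require Import structures.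
From mathcomp Require Import all_boot all_order all_algebra.
From mathcomp Require Import ring zify.
Import Order.TTheory GRing.Theory Num.Theory.
Local Open Scope ring_scope.
Set Implicit Arguments.
Unset Strict Implicit.
Unset Printing Implicit Defensive.


(** Let [y = L^-1 e_i].  Forward substitution reads [c_k^T g_k + f_k y_k = delta_ki]
with the state [g_{k+1} = S_k (g_k + y_k w_k)], which vanishes up to index [i].
The energy still to come, [sum_(j > k) y_j^2], is a quadratic form in the state
[g_{k+1}], and its matrix obeys the backward recursion: it is [P_k].  So
[|L^-1 e_i|^2 = f_i^-2 (1 + w_i^T S_i P_i S_i w_i) = b_i].

For the cost, each entry of [P_i], of [R_i] and each partial sum of [R_i w_i]
takes a bounded number of operations, and there are [p^2] of each. *)

(** * Bilinear algebra of the dot product *)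

Section Dotv.

Variables (R : comPzRingType) (p : nat).
Implicit Types (u v x : 'cV[R]_p) (a : R) (M : 'M[R]_p).

Lemma dotvE u v : dotv u v = \sum_k u k 0 * v k 0.
Proof. by rewrite /dotv mxE; apply: eq_bigr => k _; rewrite mxE. Qed.

Lemma dotvC u v : dotv u v = dotv v u.
Proof. by rewrite !dotvE; apply: eq_bigr => k _; rewrite mulrC. Qed.

Lemma dotvDr u v x : dotv u (v + x) = dotv u v + dotv u x.
Proof. by rewrite /dotv mulmxDr mxE. Qed.

Lemma dotvZr u a v : dotv u (a *: v) = a * dotv u v.
Proof. by rewrite /dotv -scalemxAr mxE. Qed.

Lemma dotvNr u v : dotv u (- v) = - dotv u v.
Proof. by rewrite /dotv mulmxN mxE. Qed.

Lemma dotvDl u v x : dotv (v + x) u = dotv v u + dotv x u.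
Proof. by rewrite dotvC dotvDr !(dotvC u). Qed.

Lemma dotvZl u a v : dotv (a *: v) u = a * dotv v u.
Proof. by rewrite dotvC dotvZr dotvC. Qed.

Lemma dotv0r u : dotv u 0 = 0.
Proof. by rewrite /dotv mulmx0 mxE. Qed.

Lemma dotv_mulmxl M u v : dotv (M *m u) v = dotv u (M^T *m v).
Proof. by rewrite /dotv trmx_mul -mulmxA. Qed.

Lemma dotv_outer u v x z : dotv u (v *m x^T *m z) = dotv u v * dotv x z.
Proof. by rewrite /dotv -mulmxA (mulmxA _ v) mxE big_ord1. Qed.

Lemma dotv_sumr (I : Type) (r : seq I) (P : pred I) u (F : I -> 'cV[R]_p) :
  dotv u (\sum_(i <- r | P i) F i) = \sum_(i <- r | P i) dotv u (F i).
Proof. by rewrite /dotv mulmx_sumr summxE. Qed.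

End Dotv.

(** * Tail energy as a quadratic form in the state *)

Section Energy.

Variables (R : fieldType) (p : nat).
Variables (c s w : nat -> 'cV[R]_p) (f : nat -> R) (N : nat).

Local Notation Rm := (seqR c s w f N).
Local Notation Pm := (seqP c s w f N).

(** Since [R_N = 0], the formulas of the recursion step hold at the last index too, whatever [w N]
    is. *)
Lemma seqpE i : (i <= N)%N -> seqp c s w f N i = Rm i *m w i.
Proof.
rewrite leq_eqVlt => /predU1P[->|ltiN]; last by case: (seq_step c s w f ltiN).
by case: (seq_last c s w f N) => -> -> _; rewrite mul0mx.
Qed.

Lemma seqbE i : (i <= N)%N ->
  seqb c s w f N i = f i ^- 2 * (1 + dotv (w i) (Rm i *m w i)).
Proof.
rewrite leq_eqVlt => /predU1P[->|ltiN].
  by case: (seq_last c s w f N) => -> _ ->; rewrite mul0mx dotv0r addr0 mulr1.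
by case: (seq_step c s w f ltiN) => _ _ <-.
Qed.

(** The cross term of [P_i] is symmetrized and [S_i] acts on both sides, so symmetry passes down the
    recursion. It merges the two mixed terms of the quadratic form below. *)
Lemma tr_rec_from k i :
  (st_R (rec_from c s w f k i))^T = st_R (rec_from c s w f k i).
Proof.
elim: k i => [|k IHk] i; first by rewrite /= trmx0.
rewrite /= !trmx_mul trmxK mulmxA /rec_P; congr (_ *m _ *m _).
rewrite !linearD !linearN !linearZ /= !trmx_mul !trmxK IHk; congr (_ + _ + _); exact: addrC.
Qed.

(** Here [y] solves the homogeneous row equation [c^T g + f y = 0] at index [i.+1]. Substituting
    [p = R w] and [b = f^-2 (1 + w^T R w)], the three terms of [P_i] become [y^2 (1 + w^T R w)],
    [2 y w^T R g] and [g^T R g]. *)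
Lemma quad_seqP i g y : (i < N)%N -> y = - (f i.+1)^-1 * dotv (c i.+1) g ->
  dotv g (Pm i *m g) =
  y ^+ 2 + dotv (g + y *: w i.+1) (Rm i.+1 *m (g + y *: w i.+1)).
Proof.
move=> ltiN ->; case: (seq_step c s w f ltiN) => -> _ _ _.
rewrite seqpE // seqbE //; set Q := Rm i.+1.
have Qsym : dotv (w i.+1) (Q *m g) = dotv g (Q *m w i.+1).
  by rewrite dotvC dotv_mulmxl /Q /seqR tr_rec_from.
rewrite mulmxDr -scalemxAr !mulmxDl mulNmx -!scalemxAl mulmxDl.
rewrite !(dotvDr, dotvDl, dotvNr, dotvZr, dotvZl) !dotv_outer Qsym.
(* With [f ^- 2] written as a square of the inverse, the identity is polynomial in [f^-1]. *)
rewrite (dotvC g (c _)) (dotvC (Q *m _) g) -exprVn.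
by ring.
Qed.

(** Descending induction from [N], where [R_N = 0]. The form is taken at [g k + y k *: w k], before
    [S_k] acts; as [R_k = S_k^T P_k S_k], it equals the form of [P_k] at [g k.+1]. Only rows after
    [k] are used, so [k = i] is allowed. *)
Lemma tail_energy i (y : nat -> R) (g : nat -> 'cV[R]_p) :
    (forall k, (i <= k < N)%N -> g k.+1 = diagv s k *m (g k + y k *: w k)) ->
    (forall k, (i < k <= N)%N -> f k != 0) ->
    (forall k, (i < k <= N)%N -> dotv (c k) (g k) + f k * y k = 0) ->
  forall k, (i <= k <= N)%N ->
  \sum_(k <= j < N.+1) y j ^+ 2 =
  y k ^+ 2 + dotv (g k + y k *: w k) (Rm k *m (g k + y k *: w k)).
Proof.
move=> gS f_neq0 row0 k /andP[leik lekN].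
have [m Dm] : {m | m = N - k}%N by exists (N - k)%N.
elim: m k Dm leik lekN => [|m IHm] k Dm leik lekN.
  have -> : k = N by lia.
  rewrite big_nat1; case: (seq_last c s w f N) => -> _ _.
  by rewrite mul0mx dotv0r addr0.
have ltkN : (k < N)%N by lia.
rewrite big_ltn ?ltnS // IHm; [|lia|lia|lia].
congr (_ + _); case: (seq_step c s w f ltkN) => _ -> _ _.
have kr : (i < k.+1 <= N)%N by lia.
(* Row [k.+1] is homogeneous and determines [y k.+1] from the state. *)
rewrite -quad_seqP //; last first.
  apply: (mulfI (f_neq0 _ kr)); rewrite mulrA mulrN divff ?f_neq0 //.
  by rewrite mulN1r; apply/eqP; rewrite -addr_eq0 addrC row0.
rewrite gS; last lia.
by rewrite dotv_mulmxl !mulmxA.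
Qed.

(* Column [i] of [L^-1] starts at row [i], where the state is still zero. *)
Lemma seqb_energy i (y : nat -> R) (g : nat -> 'cV[R]_p) :
    (i <= N)%N ->
    (forall k, (i <= k < N)%N -> g k.+1 = diagv s k *m (g k + y k *: w k)) ->
    (forall k, (i <= k <= N)%N -> f k != 0) ->
    (forall k, (i <= k <= N)%N -> dotv (c k) (g k) + f k * y k = (k == i)%:R) ->
    g i = 0 ->
  seqb c s w f N i = \sum_(i <= k < N.+1) y k ^+ 2.
Proof.
move=> leiN gS f_neq0 row gi0.
rewrite (tail_energy gS) ?leqnn //; first last.
- by move=> k kr; rewrite row; [rewrite gtn_eqF //|]; lia.
- by move=> k kr; apply: f_neq0; lia.
have ii : (i <= i <= N)%N by rewrite leqnn.
have -> : y i = (f i)^-1.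
  apply: (mulfI (f_neq0 _ ii)); rewrite divff ?f_neq0 //.
  by have := row _ ii; rewrite gi0 dotv0r add0r eqxx.
rewrite seqbE // gi0 add0r -scalemxAr dotvZr dotvZl -exprVn.
by ring.
Qed.

End Energy.

(** * Forward substitution for a column of the inverse factor *)

Lemma prodgtS (R : pzRingType) (p : nat) (S : nat -> 'M[R]_p) i j :
  (j <= i.+1)%N -> prodgt S i.+1 j = S i.+1 *m prodgt S i j.
Proof.
move=> leji; rewrite /prodgt /index_iota subSn // -addn1 iotaD rev_cat /=.
by rewrite subnKC // big_cons.
Qed.

Lemma prodgt_gt (R : pzRingType) (p : nat) (S : nat -> 'M[R]_p) i j :
  (i < j)%N -> prodgt S i j = 1%:M.
Proof.
by move=> ltij; rewrite /prodgt /index_iota (eqP ltij) big_nil.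
Qed.

Section ColumnNorm.

Variables (R : fieldType) (N p : nat) (L : 'M[R]_N).
Variables (c s w : nat -> 'cV[R]_p) (f : nat -> R).

(** Read through the representation of [L], the rows of [L x = e_i] are the equations that
    [seqb_energy] asks for. *)
Lemma seqb_column_norm (i : 'I_N) (x : 'cV[R]_N) :
    (forall k j : 'I_N, (k < j)%N -> L k j = 0) ->
    (forall k : 'I_N, L k k = f k.+1) ->
    (forall k j : 'I_N, (j < k)%N ->
       L k j = dotv (c k.+1) (prodgt (diagv s) k j.+1 *m w j.+1)) ->
    (forall k, (0 < k <= N)%N -> f k != 0) ->
    L *m x = stdvec R i ->
  seqb c s w f N i.+1 = \sum_k x k 0 ^+ 2.
Proof.
case: N L i x => [|n] L' i x; first by case: i.
move=> Lup Ldiag Llow f_neq0 Lx.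
(* [y] is [x] with 1-based indices; [g] is the closed form of the state, so that [c_k^T g_k] is the
   part of row [k] left of the diagonal. *)
pose y k := x (inord k.-1) 0.
pose g k := \sum_(1 <= j < k) y j *: (prodgt (diagv s) k.-1 j *m w j).
have gS k : (0 < k)%N -> g k.+1 = diagv s k *m (g k + y k *: w k).
  case: k => // k _; rewrite /g big_nat_recr //= mulmxDr mulmx_sumr.
  rewrite prodgtS // prodgt_gt // mulmx1 -scalemxAr; congr (_ + _).
  apply: eq_big_nat => j jr; rewrite -scalemxAr mulmxA -prodgtS //; lia.
have row k : (0 < k <= n.+1)%N ->
    dotv (c k) (g k) + f k * y k = (k == i.+1)%:R.
  case: k => // k kn; pose ko : 'I_n.+1 := Ordinal kn.
  have /(congr1 (fun M : 'cV_n.+1 => M ko 0)) := Lx.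
  rewrite !mxE andbT eqSS -(inj_eq val_inj) /= => <-.
  (* Summing over natural numbers lets the row be cut into the entries before the diagonal, the
     diagonal entry and the zeros after it. *)
  rewrite (eq_bigr (fun j : 'I_n.+1 => L' ko (inord j) * y j.+1)); last first.
    by move=> j _; rewrite /y /= inord_val.
  rewrite -(big_mkord xpredT (fun j => L' ko (inord j) * y j.+1)).
  rewrite (@big_cat_nat _ _ _ k.+1) //= big_nat_recr //=.
  rewrite [X in _ = _ + X]big_nat [X in _ = _ + X]big1 ?addr0 => [|j jr]; last first.
    by rewrite Lup ?mul0r // inordK /=; lia.
  have -> : inord k = ko by apply: val_inj; rewrite /= inordK.
  rewrite Ldiag; congr (_ + _); rewrite dotv_sumr big_add1 /=.
  apply: eq_big_nat => j jr.
  have jE : (inord j : 'I_n.+1) = j :> nat by rewrite inordK //; lia.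
  by rewrite Llow ?jE ?dotvZr /=; [rewrite mulrC|lia].
(* The 1-based index of the unit entry is [i.+1], so rows up to [i] are homogeneous; once the
   earlier [y] vanish, so does the state. *)
have y0 k : (0 < k <= i)%N -> y k = 0.
  elim/ltn_ind: k => k IHk kr.
  have kn : (0 < k <= n.+1)%N by have := ltn_ord i; lia.
  have := row _ kn; rewrite /g big_nat big1 => [|j jr]; last first.
    by rewrite IHk ?scale0r //; lia.
  rewrite dotv0r add0r ltn_eqF; last lia.
  by move/eqP; rewrite mulf_eq0 (negPf (f_neq0 _ kn)) => /eqP.
rewrite (@seqb_energy _ _ _ _ _ _ _ _ y g) //; first last.
- by rewrite /g big_nat big1 // => j jr; rewrite y0 ?scale0r.
- by move=> k kr; apply: row; lia.
- by move=> k kr; apply: f_neq0; lia.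
- by move=> k kr; apply: gS; lia.
have -> : \sum_(i.+1 <= k < n.+2) y k ^+ 2 = \sum_(1 <= k < n.+2) y k ^+ 2.
  rewrite [RHS](@big_cat_nat _ _ _ i.+1) //=; last by have := ltn_ord i; lia.
  rewrite [X in _ = X + _]big_nat [X in _ = X + _]big1 ?add0r // => k kr.
  by rewrite y0 ?expr0n.
rewrite big_add1 big_mkord; apply: eq_bigr => k _.
by rewrite /y /= inord_val.
Qed.

End ColumnNorm.

Lemma lower_unitmx (R : numFieldType) (N : nat) (L : 'M[R]_N) :
    (forall i j : 'I_N, (i < j)%N -> L i j = 0) ->
    (forall i : 'I_N, 0 < L i i) ->
  L \in unitmx.
Proof.
move=> Lup Lpos; rewrite unitmxE det_trig; last exact/is_trig_mxP.
by rewrite unitfE prodf_seq_neq0; apply/allP => i _; rewrite gt_eqF.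
Qed.

(** * Straight-line programs with operation counts *)

Section StraightLine.

Variables (R : fieldType) (X D : Type) (inp : D -> X -> R) (ok : D -> Prop).
Implicit Types (prog : slp X) (q a b : D -> R).

Lemma slp_run_rcons (x : X -> R) vals prog ins :
  slp_run x vals (rcons prog ins) =
  obind (fun vs => omap (rcons vs)
           (arith_val (ins_op ins) (operand_val x vs (ins_lhs ins))
                                   (operand_val x vs (ins_rhs ins))))
        (slp_run x vals prog).
Proof.
elim: prog vals => [|i prog IHprog] vals /=; first by case: arith_val.
by case: arith_val => //= v; apply: IHprog.
Qed.

Lemma size_slp_run (x : X -> R) vals prog vs :
  slp_run x vals prog = Some vs -> size vs = (size vals + size prog)%N.
Proof.
elim: prog vals => [|i prog IHprog] vals /=; first by case=> <-; rewrite addn0.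
by case: arith_val => //= v /IHprog->; rewrite size_rcons addSnnS.
Qed.

(** A place past the end of the memory reads 0 but may change when the memory grows; this test
    excludes it. *)
Definition in_range (n : nat) (o : operand X) : bool :=
  if o is Result k then (k < n)%N else true.

Lemma operand_val_rcons (x : X -> R) vs v o :
  in_range (size vs) o -> operand_val x (rcons vs v) o = operand_val x vs o.
Proof. by case: o => //= k ltk; rewrite nth_rcons ltk. Qed.

(* [q] has the same place in the memory of [prog] for all valid data. *)
Definition available prog q := exists2 o, in_range (size prog) o &
  forall d, ok d -> exists2 vals, slp_run (inp d) [::] prog = Some vals &
    operand_val (inp d) vals o = q d.

Definition extends n prog prog' :=
  (size prog' <= size prog + n)%N /\
  forall q, available prog q -> available prog' q.

(* Quantifying over all extensions of [prog] lets computations be chained without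
   tracking the programs that they append. *)
Definition computable n prog q := forall prog',
    (forall a, available prog a -> available prog' a) ->
  exists2 prog'', extends n prog' prog'' & available prog'' q.

Lemma extends_refl n prog : extends n prog prog.
Proof. by split=> //; apply: leq_addr. Qed.

Lemma extends_trans n m prog1 prog2 prog3 :
  extends n prog1 prog2 -> extends m prog2 prog3 -> extends (n + m) prog1 prog3.
Proof.
move=> [le12 sub12] [le23 sub23]; split=> [|q /sub12/sub23//].
by rewrite addnA (leq_trans le23) // leq_add2r.
Qed.

Lemma eq_available prog q a :
  (forall d, ok d -> q d = a d) -> available prog q -> available prog a.
Proof.
by move=> eqq [o o_in oE]; exists o => // d okd; rewrite -eqq //; apply: oE.
Qed.

Lemma available_computable prog q : available prog q -> computable 0 prog q.
Proof. by move=> av prog' sub; exists prog'; [apply: extends_refl | apply: sub]. Qed.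

Lemma available_nil q :
  (exists2 o, in_range 0 o & forall d, ok d -> operand_val (inp d) [::] o = q d) ->
  available [::] q.
Proof. by case=> o o_in oE; exists o => // d okd; exists [::] => //; apply: oE. Qed.

(** One appended instruction puts its result at index [size prog]; memory grows only at its end, so
    earlier places keep their values. The last hypothesis also ensures that no division aborts. *)
Lemma available_op op a b q prog :
    available prog a -> available prog b ->
    (forall d, ok d -> arith_val op (a d) (b d) = Some (q d)) ->
  exists2 prog', extends 1 prog prog' & available prog' q.
Proof.
move=> [oa oa_in oaE] [ob ob_in obE] opE.
pose prog' := rcons prog (Instr op oa ob).
have run' d vs : ok d -> slp_run (inp d) [::] prog = Some vs ->
    slp_run (inp d) [::] prog' = Some (rcons vs (q d)).
  move=> okd run; rewrite slp_run_rcons run /=.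
  have [vs1] := oaE d okd; rewrite run => -[<-] ->.
  have [vs2] := obE d okd; rewrite run => -[<-] ->.
  by rewrite opE.
exists prog'; last first.
  exists (Result (size prog)); first by rewrite /= size_rcons.
  move=> d okd; have [vs run _] := oaE d okd; exists (rcons vs (q d)).
    exact: run'.
  by rewrite /= nth_rcons (size_slp_run run) ltnn eqxx.
split=> [|r [o o_in oE]]; first by rewrite size_rcons addn1.
exists o; first by case: o o_in {oE} => //= k /ltnW; rewrite size_rcons.
move=> d okd; have [vs run <-] := oE d okd; exists (rcons vs (q d)).
  exact: run'.
by rewrite operand_val_rcons // (size_slp_run run).
Qed.

(** The second operand is computed in the program already extended for the first, which stays
    available; one more instruction combines them. *)
Lemma computable_op op n m a b q prog :
    (forall d, ok d -> arith_val op (a d) (b d) = Some (q d)) ->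
    computable n prog a -> computable m prog b ->
  computable (n + m).+1 prog q.
Proof.
move=> opE compa compb prog1 sub1.
have [prog2 ext12 av2] := compa _ sub1.
have sub2 r : available prog r -> available prog2 r.
  by case: ext12 => _ sub12 /sub1/sub12.
have [prog3 ext23 av3] := compb _ sub2.
have [_ sub23] := ext23.
have [prog4 ext34 av4] := available_op (sub23 _ av2) av3 opE.
exists prog4 => //; rewrite -addn1.
exact: extends_trans (extends_trans ext12 ext23) ext34.
Qed.

Lemma computableD n m a b prog :
  computable n prog a -> computable m prog b ->
  computable (n + m).+1 prog (fun d => a d + b d).
Proof. exact: (@computable_op OpAdd). Qed.

Lemma computableB n m a b prog :
  computable n prog a -> computable m prog b ->
  computable (n + m).+1 prog (fun d => a d - b d).
Proof. exact: (@computable_op OpSub). Qed.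

Lemma computableM n m a b prog :
  computable n prog a -> computable m prog b ->
  computable (n + m).+1 prog (fun d => a d * b d).
Proof. exact: (@computable_op OpMul). Qed.

Lemma computable_div n m a b prog : (forall d, ok d -> b d != 0) ->
  computable n prog a -> computable m prog b ->
  computable (n + m).+1 prog (fun d => a d / b d).
Proof.
by move=> b_neq0; apply: (@computable_op OpDiv) => d /b_neq0 /negPf /= ->.
Qed.

Lemma eq_computable n prog q a : (forall d, ok d -> q d = a d) ->
  computable n prog q -> computable n prog a.
Proof.
move=> eqq comp prog' /comp[prog'' ext av]; exists prog'' => //.
exact: eq_available av.
Qed.

(** Each term costs [n] plus one addition, the accumulation starting from the available 0. *)
Lemma computable_sum (I : finType) n prog (q : I -> D -> R) :
    available prog (fun=> 0) ->
    (forall i, computable n prog (q i)) ->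
  computable (#|I| * n.+1) prog (fun d => \sum_i q i d).
Proof.
move=> av0 compq; rewrite cardT enumT -[X in size X]/(index_enum I).
elim: (index_enum I) => [|i r IHr].
  apply: (eq_computable (q := fun=> 0)) => [d _|]; first by rewrite big_nil.
  exact: available_computable.
apply: (eq_computable (q := fun d => q i d + \sum_(j <- r) q j d)).
  by move=> d _; rewrite big_cons.
by rewrite mulSn addSn; apply: computableD.
Qed.

Lemma computable_family (I : finType) n prog (q : I -> D -> R) :
    (forall i, computable n prog (q i)) ->
  exists2 prog', extends (#|I| * n) prog prog' &
    forall i, available prog' (q i).
Proof.
move=> compq.
suffices [prog' ext av] : exists2 prog', extends (size (enum I) * n) prog prog' &
    forall i, i \in enum I -> available prog' (q i).
  exists prog'; first by rewrite cardE.
  by move=> i; apply: av; rewrite mem_enum.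
elim: (enum I) => [|i r [prog1 ext1 av1]].
  by exists prog => //; apply: extends_refl.
have [_ sub1] := ext1; have [prog2 ext2 av2] := compq i _ sub1.
exists prog2; first by rewrite mulSn addnC; apply: extends_trans ext1 ext2.
move=> j; rewrite inE => /predU1P[->//|/av1]; by case: ext2 => _; apply.
Qed.

(** Finiteness of [I] lets the places be chosen as one function, independent of the data. Outside
    [P] the place is an arbitrary constant. *)
Lemma available_places (I : finType) (P : pred I) prog (q : I -> D -> R) :
    (forall i, P i -> available prog (q i)) ->
  exists o : I -> operand X, forall i d vals, P i -> ok d ->
    slp_run (inp d) [::] prog = Some vals ->
  operand_val (inp d) vals (o i) = q i d.
Proof.
move=> av.
apply: (@fin_all_exists I (fun=> operand X)
  (fun i o => forall d vals, P i -> ok d ->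
    slp_run (inp d) [::] prog = Some vals -> operand_val (inp d) vals o = q i d)).
move=> i; have [Pi|nPi] := boolP (P i); last first.
  by exists (Const 0) => d vals Pi; case/negP: nPi.
have [o _ oE] := av i Pi; exists o => d vals _ okd run.
by have [vs] := oE d okd; rewrite run => -[<-].
Qed.

End StraightLine.

(** * A program for the recursion and its cost *)

Section RecursionProgram.

Variables (R : fieldType) (N p : nat).

(** Bundling the inputs makes every quantity of the recursion a function of a single argument, as
    [available] requires. *)
Record rec_data := RecData {
  dc : nat -> 'cV[R]_p;
  ds : nat -> 'cV[R]_p;
  dw : nat -> 'cV[R]_p;
  df : nat -> R
}.

Definition data_val d (v : rec_input N p) : R :=
  rec_input_val (dc d) (ds d) (dw d) (df d) v.

Definition data_ok d := forall i, (1 <= i)%N -> (i <= N)%N -> df d i != 0.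

Local Notation avail := (available data_val data_ok).
Local Notation comp := (computable data_val data_ok).
Local Notation ext := (extends data_val data_ok).

Definition dR i d := seqR (dc d) (ds d) (dw d) (df d) N i.
Definition dp i d := seqp (dc d) (ds d) (dw d) (df d) N i.
Definition db i d := seqb (dc d) (ds d) (dw d) (df d) N i.
Definition dP i d := seqP (dc d) (ds d) (dw d) (df d) N i.

Definition inputs_available prog :=
  [/\ forall i k, (0 < i <= N)%N -> avail prog (fun d => dc d i k 0),
      forall i k, (0 < i <= N)%N -> avail prog (fun d => ds d i k 0),
      forall i k, (0 < i < N)%N -> avail prog (fun d => dw d i k 0),
      forall i, (0 < i <= N)%N -> avail prog (fun d => df d i) &
      forall z : int, avail prog (fun=> z%:~R)].

Lemma inputs_available_nil : inputs_available [::].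
Proof.
split=> [[|i] k //= lti|[|i] k //= lti|[|i] k //= lti|[|i] //= lti|z];
  apply: available_nil.
- by exists (Input (InC (Ordinal lti) k)).
- by exists (Input (InS (Ordinal lti) k)).
- have lti' : (i < N.-1)%N by lia.
  by exists (Input (InW (Ordinal lti') k)).
- by exists (Input (InF p (Ordinal lti))).
- by exists (Const z).
Qed.

Lemma inputs_available_sub prog prog' :
    (forall q, avail prog q -> avail prog' q) ->
  inputs_available prog -> inputs_available prog'.
Proof.
move=> sub [ac as_ aw af az].
split=> [i k|i k|i k|i|z].
- by move=> /(ac _ k)/sub.
- by move=> /(as_ _ k)/sub.
- by move=> /(aw _ k)/sub.
- by move=> /af/sub.
- exact: sub.
Qed.

Definition state_available prog i :=
  [/\ forall k l, avail prog (fun d => dR i d k l),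
      forall k, avail prog (fun d => dp i d k 0) &
      avail prog (db i)].

Lemma state_available_sub prog prog' i :
    (forall q, avail prog q -> avail prog' q) ->
  state_available prog i -> state_available prog' i.
Proof.
by move=> sub [aR ap ab]; split=> [k l|k|]; apply: sub.
Qed.

Definition Pmat_available prog i :=
  forall k l, avail prog (fun d => dP i d k l).

(* [R_N = 0] and [p_N = 0] are constants; only [b_N = 1 / (f_N * f_N)] costs. *)
Lemma last_state_program prog : (0 < N)%N -> inputs_available prog ->
  exists2 prog', ext 2 prog prog' & state_available prog' N.
Proof.
move=> N_gt0 [_ _ _ af az].
have Nr : (0 < N <= N)%N by rewrite N_gt0 leqnn.
have compb : comp 2 prog (db N).
  apply: (eq_computable (q := fun d => 1%:~R / (df d N * df d N))).
    move=> d _; rewrite /db mul1r -expr2.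
    by have [_ _ ->] := seq_last (dc d) (ds d) (dw d) (df d) N.
  apply: (@computable_div _ _ _ _ _ 0 1) => [d okd||].
  - by rewrite mulf_neq0 // okd.
  - exact: available_computable.
  - by apply: (@computableM _ _ _ _ _ 0 0); apply/available_computable/af.
have [prog' ext' av'] := compb prog (fun _ => id).
have az' : avail prog' (fun=> 0) by case: ext' => _; apply; apply: (az 0).
exists prog' => //; split=> // [k l|k];
  apply: eq_available az' => d _; rewrite /dR /dp;
  have [RN pN _] := seq_last (dc d) (ds d) (dw d) (df d) N;
  by rewrite ?RN ?pN mxE.
Qed.

(** The count is [8 p^2] for [P_i], [2 p^2] for [R_i], [2 p^2] for [p_i] and [2 p + 3] for [b_i]. *)
Lemma state_program prog i : (0 < i < N)%N ->
    inputs_available prog -> state_available prog i.+1 ->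
  exists2 prog', ext (12 * p ^ 2 + 2 * p + 3) prog prog' &
    Pmat_available prog' i /\ state_available prog' i.
Proof.
move=> ir inp0 [aR ap ab].
have [i_gt0 ltiN] := andP ir.
have step d := seq_step (dc d) (ds d) (dw d) (df d) ltiN.
have cav := @available_computable _ _ _ data_val data_ok.
have mul00 := @computableM _ _ _ data_val data_ok 0 0.
(* Per entry: 2 operations for [b c c], 3 for the cross term, 1 division by [f], then a subtraction
   and an addition. *)
have [prog1 ext1 aP1] : exists2 prog', ext (#|{: 'I_p * 'I_p}| * 8) prog prog' &
    forall kl : 'I_p * 'I_p, avail prog' (fun d => dP i d kl.1 kl.2).
  apply: computable_family => -[k l] /=; case: inp0 => ac _ _ af _.
  apply: (eq_computable (q := fun d => db i.+1 d * (dc d i.+1 k 0 * dc d i.+1 l 0)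
    - (dc d i.+1 k 0 * dp i.+1 d l 0 + dp i.+1 d k 0 * dc d i.+1 l 0) / df d i.+1
    + dR i.+1 d k l)).
    move=> d _; rewrite /dP; have [-> _ _ _] := step d.
    by rewrite !mxE !big_ord1 !mxE (mulrC (df d i.+1)^-1).
  have c0 j : comp 0 prog (fun d => dc d i.+1 j 0) by apply/cav/ac.
  have p0 j : comp 0 prog (fun d => dp i.+1 d j 0) by apply/cav/ap.
  apply: (@computableD _ _ _ _ _ 7 0); last exact/cav/aR.
  apply: (@computableB _ _ _ _ _ 2 4).
    by apply: (@computableM _ _ _ _ _ 0 1); [exact/cav | exact: mul00].
  apply: (@computable_div _ _ _ _ _ 3 0); [by move=> d okd; apply: okd| |exact/cav/af].
  by apply: (@computableD _ _ _ _ _ 1 1); apply: mul00.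
have [_ sub1] := ext1; have inp1 := inputs_available_sub sub1 inp0.
(* As [S_i] is diagonal, each entry of [R_i] is [s_k P_kl s_l]: two multiplications and no matrix
   product, which keeps the cost quadratic in [p]. *)
have [prog2 ext2 aR2] : exists2 prog', ext (#|{: 'I_p * 'I_p}| * 2) prog1 prog' &
    forall kl : 'I_p * 'I_p, avail prog' (fun d => dR i d kl.1 kl.2).
  apply: computable_family => -[k l] /=; case: inp1 => _ as_ _ _ _.
  apply: (eq_computable (q := fun d => ds d i k 0 * dP i d k l * ds d i l 0)).
    move=> d _; rewrite /dR; have [_ -> _ _] := step d.
    by rewrite /diagv tr_diag_mx mul_mx_diag mul_diag_mx !mxE.
  have s0 j : comp 0 prog1 (fun d => ds d i j 0) by apply/cav/as_; lia.
  apply: (@computableM _ _ _ _ _ 1 0) => //.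
  by apply: mul00 => //; apply/cav/(aP1 (k, l)).
have [_ sub2] := ext2; have inp2 := inputs_available_sub sub2 inp1.
have w0 prog' j : inputs_available prog' -> comp 0 prog' (fun d => dw d i j 0).
  by case=> _ _ aw _ _; apply/cav/aw.
have z0 prog' : inputs_available prog' -> avail prog' (fun=> 0).
  by case=> _ _ _ _ az; apply: (az 0).
have [prog3 ext3 ap3] : exists2 prog', ext (#|'I_p| * (p * 2)) prog2 prog' &
    forall k, avail prog' (fun d => dp i d k 0).
  apply: computable_family => k.
  apply: (eq_computable (q := fun d =>
    \sum_j dR i d k j * dw d i j 0)).
    by move=> d _; rewrite /dp; have [_ _ -> _] := step d; rewrite mxE.
  have -> : (p * 2 = #|'I_p| * 2)%N by rewrite card_ord.
  apply: computable_sum; first exact: z0.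
  by move=> j; apply: mul00; [apply/cav/(aR2 (k, j)) | apply: w0].
have [_ sub3] := ext3; have inp3 := inputs_available_sub sub3 inp2.
(* The dot product takes [2 p] operations; adding 1, squaring [f] and dividing take the other 3. *)
have compb : comp (p * 2 + 3) prog3 (db i).
  case: (inp3) => _ _ _ af az.
  apply: (eq_computable (q := fun d =>
    (1%:~R + \sum_j dw d i j 0 * dp i d j 0)
      / (df d i * df d i))).
    move=> d _; rewrite /db; have [_ _ _ ->] := step d.
    rewrite mulrC expr2 /dotv mxE; congr (_ * (1 + _)).
    by apply: eq_bigr => j _; rewrite mxE.
  have -> : (p * 2 + 3 = ((0 + p * 2).+1 + 1).+1)%N by lia.
  apply: (@computable_div _ _ _ _ _ _ 1) => [d okd||].
  - by rewrite mulf_neq0 // okd // ltnW.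
  - apply: (@computableD _ _ _ _ _ 0); first exact/cav.
    have -> : (p * 2 = #|'I_p| * 2)%N by rewrite card_ord.
  apply: computable_sum; first exact: z0.
    by move=> j; apply: mul00; [apply: w0 | apply/cav/ap3].
  by apply: mul00; apply/cav/af; lia.
have [prog4 ext4 ab4] := compb prog3 (fun _ => id).
have [_ sub4] := ext4; exists prog4.
  have [le4 sub] := extends_trans (extends_trans (extends_trans ext1 ext2) ext3) ext4.
  split=> //; apply: leq_trans le4 _; rewrite leq_add2l card_prod card_ord; nia.
split=> [k l|]; first by apply/sub4/sub3/sub2/(aP1 (k, l)).
by split=> [k l|k|//]; [apply/sub4/sub3/(aR2 (k, l)) | apply/sub4/ap3].
Qed.

Lemma recursion_program : (0 < p)%N ->
  exists2 prog : slp (rec_input N p),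
    (size prog <= 18 * (N * p ^ 2))%N & evaluates_recursion R prog.
Proof.
move=> p_gt0; have [N0|N_gt0] := posnP N.
  exists [::] => //.
  exists (fun _ _ _ => Const 0), (fun _ _ _ => Const 0).
  exists (fun _ _ => Const 0), (fun _ => Const 0).
  by move=> c s w f _; exists [::] => //; split=> [i k l|i k l|i k|i]; lia.
have [prog [size_prog inp avR avP]] : exists prog,
    [/\ (size prog <= 2 + (N - 1) * (12 * p ^ 2 + 2 * p + 3))%N,
        inputs_available prog,
        forall i, (1 <= i <= N)%N -> state_available prog i &
        forall i, (1 <= i < N)%N -> Pmat_available prog i].
  (* After [m] backward steps from [N], all states and matrices computed so far are still
     available. *)
  suffices backward m : (m < N)%N -> exists prog,
      [/\ (size prog <= 2 + m * (12 * p ^ 2 + 2 * p + 3))%N,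
          inputs_available prog,
          forall i, (N - m <= i <= N)%N -> state_available prog i &
          forall i, (N - m <= i < N)%N -> Pmat_available prog i].
    have [|prog] := backward (N - 1)%N; first lia.
    by rewrite subKn // => ?; exists prog.
  elim: m => [|m IHm] ltm.
    have [prog ext0 st] := last_state_program N_gt0 inputs_available_nil.
    have [size_prog sub] := ext0; exists prog; split=> //.
    - exact: inputs_available_sub inputs_available_nil.
    - by move=> i; rewrite subn0 -eqn_leq => /eqP <-.
    - by move=> i; rewrite subn0; lia.
  have [prog [size_prog inp st stP]] := IHm (ltnW ltm).
  have [||prog' [size_prog' sub] [newP new]] := @state_program prog (N - m.+1) _ inp.
  - lia.
  - by apply: st; lia.
  exists prog'; split=> [||i ir|i ir].
  - by rewrite mulSn; lia.
  - exact: inputs_available_sub inp.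
  - have [->//|neqi] := eqVneq i (N - m.+1)%N.
    by apply: state_available_sub sub _; apply: st; lia.
  - have [->//|neqi] := eqVneq i (N - m.+1)%N.
    by move=> k l; apply: sub; apply: stP; lia.
exists prog.
  apply: leq_trans size_prog _.
  (* As [p >= 1], a step costs at most [17 p^2]; the 2 operations of the last state fit in the slack
     up to [18 N p^2]. *)
  have leK : (12 * p ^ 2 + 2 * p + 3 <= 17 * p ^ 2)%N by nia.
  have := leq_mul (leqnn (N - 1)) leK.
  have q_gt0 : (0 < p ^ 2)%N by rewrite expn_gt0 p_gt0.
  by nia.
(* Indices 1 to [N] live in ['I_N.+1], with 0 excluded by the predicate. *)
have [oP oPE] := @available_places _ _ _ data_val data_ok
  ('I_N.+1 * 'I_p * 'I_p)%type (fun t => (0 < t.1.1 < N)%N) prog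
  (fun t d => dP t.1.1 d t.1.2 t.2) (fun t tr => avP _ tr t.1.2 t.2).
have [|oR oRE] := @available_places _ _ _ data_val data_ok
  ('I_N.+1 * 'I_p * 'I_p)%type (fun t => (0 < t.1.1)%N) prog
  (fun t d => dR t.1.1 d t.1.2 t.2).
  by move=> t tr; case: (avR t.1.1); first by rewrite tr -ltnS ltn_ord.
have [|op opE] := @available_places _ _ _ data_val data_ok
  ('I_N.+1 * 'I_p)%type (fun t => (0 < t.1)%N) prog
  (fun t d => dp t.1 d t.2 0).
  by move=> t tr; case: (avR t.1); first by rewrite tr -ltnS ltn_ord.
have [|ob obE] := @available_places _ _ _ data_val data_ok
  'I_N.+1 (fun t => (0 < t)%N) prog (fun t d => db t d).
  by move=> t tr; case: (avR t); first by rewrite tr -ltnS ltn_ord.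
exists (fun i k l => oP (inord i, k, l)), (fun i k l => oR (inord i, k, l)).
exists (fun i k => op (inord i, k)), (fun i => ob (inord i)).
move=> c s w f f_neq0; pose d := RecData c s w f.
have okd : data_ok d by [].
(* Availability of the constant 0 already contains a successful run on [d]. *)
have [_ _ _ _ /(_ 0)[o _ /(_ d okd)[vals run _]]] := inp.
exists vals => //= ; split=> [i k l i_gt0 ltiN|i k l i_gt0 leiN|i k i_gt0 leiN|i i_gt0 leiN].
- have iE : (inord i : 'I_N.+1) = i :> nat by rewrite inordK // ltnW.
  by rewrite [LHS](oPE (inord i, k, l) d) /= ?iE ?i_gt0.
- have iE : (inord i : 'I_N.+1) = i :> nat by rewrite inordK.
  by rewrite [LHS](oRE (inord i, k, l) d) /= ?iE.
- have iE : (inord i : 'I_N.+1) = i :> nat by rewrite inordK.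
  by rewrite [LHS](opE (inord i, k) d) /= ?iE.
- have iE : (inord i : 'I_N.+1) = i :> nat by rewrite inordK.
  by rewrite [LHS](obE (inord i) d) /= ?iE.
Qed.

End RecursionProgram.

(** * Diagonal of the inverse as column norms, and conclusion *)

Lemma invmxM (R : comUnitRingType) (n : nat) (A B : 'M[R]_n) :
  A \in unitmx -> B \in unitmx -> invmx (A *m B) = invmx B *m invmx A.
Proof.
move=> Au Bu; have ABu : A *m B \in unitmx by rewrite unitmx_mul Au.
apply: (can_inj (mulKmx ABu)).
by rewrite mulmxV // -mulmxA (mulmxA B) mulmxV // mul1mx mulmxV.
Qed.

Theorem mainTheorem5 (R : rcfType) :
  (forall (N p : nat) (A L : 'M[R]_N) (c s nu w : nat -> 'cV[R]_p)
      (d f : nat -> R),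
    let D := diag_mx (\row_(i < N) d i.+1) in
    semiseparable p A ->
    givens_vector_rep A c s nu ->
    (forall i : nat, (1 <= i)%N -> (i <= N)%N -> 0 < d i) ->
    posdef (A + D) ->
    is_cholesky (A + D) L ->
    cholesky_rep L c s nu d w f ->
    (forall i : nat, (1 <= i)%N -> (i <= N)%N -> 0 < f i) ->
    forall i : 'I_N,
      [/\ seqb c s w f N i.+1 = invmx (A + D) i i,
          seqb c s w f N i.+1
            = ((stdvec R i)^T *m invmx (A + D) *m stdvec R i) 0 0 &
          seqb c s w f N i.+1 = norm2 (invmx L *m stdvec R i) ^+ 2])
  /\
  (exists C : nat, forall N p : nat, (0 < p)%N ->
     exists2 prog : slp (rec_input N p),
       (size prog <= C * (N * p ^ 2))%N & evaluates_recursion R prog).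
Proof.
split; last by exists 18 => N p; apply: recursion_program.
move=> N p A L c s nu w d f D _ _ _ _ [Lup Lpos ->] [Llow Ldiag _ _] f_gt0 i.
have Lunit := lower_unitmx Lup Lpos.
pose x := invmx L *m stdvec R i.
have bE : seqb c s w f N i.+1 = \sum_k x k 0 ^+ 2.
  apply: (seqb_column_norm Lup Ldiag Llow) => [k /andP[k_gt0 lekN]|].
    by rewrite gt_eqF ?f_gt0.
  by rewrite mulmxA mulmxV // mul1mx.
(* Since [(L L^T)^-1 = L^-T L^-1], this quadratic form is the squared norm of [L^-1 e_i]. *)
have quadE : ((stdvec R i)^T *m invmx (L *m L^T) *m stdvec R i) 0 0 =
    \sum_k x k 0 ^+ 2.
  have -> : invmx (L *m L^T) = (invmx L)^T *m invmx L.
    by rewrite invmxM ?unitmx_tr // trmx_inv.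
  rewrite mulmxA -trmx_mul -mulmxA mxE.
  by apply: eq_bigr => k _; rewrite mxE expr2.
split; last 1 first.
- by rewrite bE sqr_sqrtr ?sumr_ge0 // => k _; apply: sqr_ge0.
- by rewrite bE -quadE /stdvec trmx_delta -rowE -colE !mxE.
- by rewrite bE quadE.
Qed.
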